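(* Let $G$ be a group and $N$ a normal subgroup of $G$. Then for every rational chain $c \in \mathcal{C}_{\mathbb{Q}}(G,N)$, \[ \mathrm{scl}_{G,N}(c) = \sup_{\mu \in \mathrm{Q}(N)^G \setminus \mathrm{H}^1(N;\mathbb{R})^G} \frac{|\mu(c)|}{2D(\mu)}, \] where the supremum over the empty set is interpreted as $0$.
   Context: Commutators: $[a,b]=aba^{-1}b^{-1}$. A quasimorphism on a group $H$ is $\phi\colon H\to\mathbb{R}$ with finite defect $D(\phi)=\sup_{h_1,h_2\in H}|\phi(h_1h_2)-\phi(h_1)-\phi(h_2)|$; it is homogeneous if $\phi(h^n)=n\phi(h)$ for all $h\in H$, $n\in\mathbb{Z}$. $\mathrm{Q}(N)^G$ denotes the real vector space of homogeneous quasimorphisms $\mu$ on $N$ that are $G$-invariant, i.e. $\mu(gxg^{-1})=\mu(x)$ for all $g\in G$, $x\in N$; $\mathrm{H}^1(N;\mathbb{R})^G$ is the subspace of $G$-invariant homomorphisms $N\to\mathbb{R}$. The mixed commutator subgroup $[G,N]$ is the subgroup generated by all $[g,x]$ with $g\in G$, $x\in N$; $\mathrm{cl}_{G,N}(y)$ for $y\in[G,N]$ is the least number of elements of the form $[g,x]$ ($g\in G,x\in N$) whose product is $y$. Chains: for a commutative unital ring $A$, $\mathrm{C}_1(G;A)$ is the free $A$-module on $G$ and $\mathrm{C}_2(G;A)$ the free $A$-module on $G\times G$; $\partial(g_1,g_2)=g_2-g_1g_2+g_1$, extended linearly. $\mathrm{C}'_2(G,N;A)$ is the submodule generated by pairs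 $(g_1,g_2)$ with $g_1\in N$ or $g_2\in N$; $\mathrm{B}'_1(G,N;A)=\partial\,\mathrm{C}'_2(G,N;A)$; $\mathcal{C}_A(G,N)=\mathrm{C}_1(N;A)\cap \mathrm{B}'_1(G,N;A)$. Mixed cl and scl of chains: for $x_1,\dots,x_m\in N$ with $x_1\cdots x_m\in[G,N]$, $\mathrm{cl}_{G,N}(x_1+\cdots+x_m)=\inf_{g_1,\dots,g_{m-1}\in G}\mathrm{cl}_{G,N}(x_1\,g_1x_2g_1^{-1}\cdots g_{m-1}x_mg_{m-1}^{-1})$ and $\mathrm{scl}_{G,N}(x_1+\cdots+x_m)=\lim_{n\to\infty}\frac1n\mathrm{cl}_{G,N}(x_1^n+\cdots+x_m^n)$ (here $x_1+\cdots+x_m$ denotes the finite list, with repetitions allowed). Every $c\in\mathcal{C}_{\mathbb{Z}}(G,N)$ can be written $c=x_1+\cdots+x_k-\check x_1-\cdots-\check x_l$ with $x_i,\check x_j\in N$ and $x_1\cdots x_k\check x_1^{-1}\cdots\check x_l^{-1}\in[G,N]$, and one sets $\mathrm{scl}_{G,N}(c)=\mathrm{scl}_{G,N}(x_1+\cdots+x_k+\check x_1^{-1}+\cdots+\check x_l^{-1})$. For $c\in\mathcal{C}_{\mathbb{Q}}(G,N)$, choose $m\in\mathbb{N}$ with $mc\in \mathcal{C}_{\mathbb{Z}}(G,N)$ and set $\mathrm{scl}_{G,N}(c)=\frac1m\mathrm{scl}_{G,N}(mc)$. For $\mu\in\mathrm{Q}(N)^G$ and $c=\sum_i t_ix_i$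 ($t_i\in\mathbb{R}$, $x_i\in N$), $\mu(c)=\sum_it_i\mu(x_i)$. *)

(* Defs.v *)
From HB Require Import structures.
From mathcomp Require Import all_boot all_order all_algebra.
From mathcomp Require Import all_classical all_reals.
From mathcomp Require Import ereal topology normedtype sequences Rstruct Rstruct_topology.
From Stdlib Require Import Rdefinitions ClassicalEpsilon.
Set Implicit Arguments. Unset Strict Implicit. Unset Printing Implicit Defensive.
Import Order.TTheory GRing.Theory Num.Theory.
Local Open Scope classical_set_scope.
Local Open Scope ring_scope.

Record group := Group {
  gcar :> Type;
  gmul : gcar -> gcar -> gcar;
  ginv : gcar -> gcar;
  gone : gcar;
  gmulA : forall a b c, gmul a (gmul b c) = gmul (gmul a b) c;
  gmul1 : forall a, gmul a gone = a;
  g1mul : forall a, gmul gone a = a;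
  gmulV : forall a, gmul a (ginv a) = gone;
  gVmul : forall a, gmul (ginv a) a = gone }.

Section GroupDefs.
Variable G : group.
Local Notation "a ** b" := (gmul a b) (at level 40, left associativity).

Definition normal_subgroup (N : G -> Prop) : Prop :=
  [/\ N (gone G), (forall a b, N a -> N b -> N (a ** b)),
      (forall a, N a -> N (ginv a)) &
      (forall g x, N x -> N (g ** x ** ginv g))].

Fixpoint gpow (x : G) (n : nat) : G :=
  match n with O => gone G | S k => x ** gpow x k end.
Definition gpowz (x : G) (n : int) : G :=
  match n with Posz k => gpow x k | Negz k => ginv (gpow x k.+1) end.

Definition gcomm (a b : G) : G := a ** b ** ginv a ** ginv b.

Definition gprod (s : seq G) : G := foldr (@gmul G) (gone G) s.

Definition comm_prod (cs : seq (G * G)) : G := gprod [seq gcomm p.1 p.2 | p <- cs].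

Definition mixed_comms (N : G -> Prop) (cs : seq (G * G)) : Prop :=
  forall p, List.In p cs -> N p.2.

Definition in_mixed_comm (N : G -> Prop) (y : G) : Prop :=
  exists cs, mixed_comms N cs /\ comm_prod cs = y.

Definition twisted_prod (xs gs : seq G) : G :=
  match xs with
  | [::] => gone G
  | x1 :: rest => x1 ** gprod [seq p.2 ** p.1 ** ginv p.2 | p <- zip rest gs]
  end.

(* cl_{G,N}(x1 + ... + xm): inf over g_1..g_{m-1} of cl_{G,N}(twisted product),
   cl_{G,N}(y) being the least number of mixed commutators with product y. *)
Definition cl_list (N : G -> Prop) (xs : seq G) : R :=
  inf [set r : R | exists (gs : seq G) (cs : seq (G * G)),
         [/\ size gs = (size xs).-1, mixed_comms N cs,
             comm_prod cs = twisted_prod xs gs & r = (size cs)%:R]].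

Definition scl_list (N : G -> Prop) (xs : seq G) : R :=
  limn (fun n : nat => cl_list N [seq gpow x n | x <- xs] / n%:R).

(* Chains: formal finite linear combinations, represented by lists of
   (coefficient, generator); two lists denote the same chain iff they have
   the same coefficient function. *)
Definition coeff (A : Type) (K : nzRingType) (c : seq (K * A)) (a : A) : K :=
  \sum_(p <- c) (if `[< p.2 = a >] then p.1 else 0).

Definition chain_eq (A : Type) (K : nzRingType) (c d : seq (K * A)) : Prop :=
  forall a, coeff c a = coeff d a.

Definition bd2 (K : nzRingType) (d : seq (K * (G * G))) : seq (K * G) :=
  flatten [seq [:: (p.1, p.2.2); (- p.1, p.2.1 ** p.2.2); (p.1, p.2.1)] | p <- d].

Definition in_C1N (K : nzRingType) (N : G -> Prop) (c : seq (K * G)) : Prop :=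
  forall g, coeff c g != 0 -> N g.

Definition in_B1' (K : nzRingType) (N : G -> Prop) (c : seq (K * G)) : Prop :=
  exists d : seq (K * (G * G)),
    (forall p, List.In p d -> N p.2.1 \/ N p.2.2) /\ chain_eq c (bd2 d).

Definition in_CQ (N : G -> Prop) (c : seq (rat * G)) : Prop :=
  in_C1N N c /\ in_B1' N c.

Definition int_rep (N : G -> Prop) (c : seq (rat * G)) (m : nat)
    (xs ys : seq G) : Prop :=
  [/\ (leq 1 m), (forall x, List.In x xs -> N x), (forall y, List.In y ys -> N y),
      in_mixed_comm N (gprod (xs ++ [seq ginv y | y <- ys])) &
      chain_eq [seq (m%:R * p.1, p.2) | p <- c]
               ([seq (1, x) | x <- xs] ++ [seq (-1, y) | y <- ys])].

Definition scl_chain (N : G -> Prop) (c : seq (rat * G)) : R :=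
  let P := fun t : nat * (seq G * seq G) => int_rep N c t.1 t.2.1 t.2.2 in
  let t := epsilon (inhabits (1%N, ([::], [::]))) P in
  scl_list N (t.2.1 ++ [seq ginv y | y <- t.2.2]) / t.1%:R.

(* quasimorphisms on N (as functions G -> R, only values on N matter) *)
Definition is_quasimorphism (N : G -> Prop) (mu : G -> R) : Prop :=
  exists D : R, forall h1 h2, N h1 -> N h2 ->
    `|mu (h1 ** h2) - mu h1 - mu h2| <= D.

Definition defect (N : G -> Prop) (mu : G -> R) : R :=
  sup [set `|mu (h1 ** h2) - mu h1 - mu h2| | h1 in N & h2 in N].

Definition is_homogeneous (N : G -> Prop) (mu : G -> R) : Prop :=
  forall h (n : int), N h -> mu (gpowz h n) = n%:~R * mu h.

Definition is_G_invariant (N : G -> Prop) (mu : G -> R) : Prop :=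
  forall g x, N x -> mu (g ** x ** ginv g) = mu x.

Definition in_QNG (N : G -> Prop) (mu : G -> R) : Prop :=
  [/\ is_quasimorphism N mu, is_homogeneous N mu & is_G_invariant N mu].

Definition is_hom_on (N : G -> Prop) (mu : G -> R) : Prop :=
  forall h1 h2, N h1 -> N h2 -> mu (h1 ** h2) = mu h1 + mu h2.

Definition eval_chain (mu : G -> R) (c : seq (rat * G)) : R :=
  \sum_(p <- c) ratr p.1 * mu p.2.

Definition bavard_set (N : G -> Prop) (c : seq (rat * G)) : set R :=
  [set `|eval_chain mu c| / (2 * defect N mu) |
       mu in [set mu | in_QNG N mu /\ ~ is_hom_on N mu]].

End GroupDefs.

(* Main.v *)
(* Up to an error depending only on the number of its entries, the mixed commutator length of a list
   x_1 + ... + x_m does not change under conjugating or permuting the x_i, and it is subadditive in the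
   exponent n of x_1^n + ... + x_m^n.  Hence scl is a sublinear function on integral chains.
   A quasimorphism mu satisfies n |mu(c)| <= D(mu) (2 cl_n + O(1)), which gives one inequality.
   For the other, Hahn-Banach provides a functional bounded by scl that attains it at c; restricted to
   the elements of N it is homogeneous and G-invariant, because scl vanishes on x^n - n x and
   on g x g^-1 - x, and its defect is at most 1/2, because (x y)^n x^-n y^-n is a product of about n/2
   commutators.  If this functional is a homomorphism on N, it vanishes on c, so scl(c) = 0. *)

From Stdlib Require Import Rdefinitions Permutation.
From mathcomp Require Import ring lra.
From mathcomp Require Import all_boot all_order all_algebra.
From mathcomp Require Import all_classical all_reals.
From mathcomp Require Import ereal topology normedtype sequences Rstruct Rstruct_topology.
Require Import Defs.
Import Order.TTheory GRing.Theory Num.Theory.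
Import numFieldNormedType.Exports.
Local Open Scope classical_set_scope.
Local Open Scope ring_scope.
(* Rdefinitions binds [R_scope] to [R], which would turn [x + y] into [Rplus x y] in arguments of type [R]. *)
Bind Scope ring_scope with R.
Set Implicit Arguments.
Unset Strict Implicit.
Unset Printing Implicit Defensive.

(** * Hahn-Banach for abelian groups *)

Section Cone.
Variable A : zmodType.
Implicit Types (K : set (A * R)) (a v : A) (r s t : R).

(* The epigraph of a partially defined sublinear function on the abelian group [A]. *)
Definition epicone K :=
  [/\ forall a r b s, K (a, r) -> K (b, s) -> K (a + b, r + s),
      forall r, K (0, r) -> 0 <= r &
      forall a r, K (a, r) -> exists s, K (- a, s)].

Lemma epicone_muln K a r n : epicone K -> K (0, 0) -> K (a, r) ->
  K (a *+ n, r *+ n).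
Proof.
case=> Kadd _ _ K0 Kar; elim: n => [|n IH]; first by rewrite !mulr0n.
by rewrite !mulrSr; exact: Kadd.
Qed.

(** Upper bounds on the slope come from positive multiples of [v], lower bounds from negative ones.
    They are compatible: adding [n] copies of a point over [v *+ m] to [m] copies of a point over
    [- v *+ n] gives a point over [0], hence of nonnegative height. *)
Lemma epicone_slope K v : epicone K -> K (0, 0) ->
  exists t, forall (n : int) s, K (v *~ n, s) -> n%:~R * t <= s.
Proof.
move=> coneK K0; have [Kadd Kpos Ksym] := coneK.
have cross m n u s : K (v *+ m, u) -> K (- v *+ n, s) -> 0 <= u *+ n + s *+ m.
  move=> /(epicone_muln n coneK K0) H1 /(epicone_muln m coneK K0) H2.
  have := Kadd _ _ _ _ H1 H2.
  rewrite mulNrn mulNrn mulrnAC subrr; exact: Kpos.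
have Kv0 s : K (v *~ 0, s) -> 0 <= s by rewrite mulr0z; exact: Kpos.
(* The upper bounds on the slope; when there are any, their infimum is a valid choice. *)
pose U := [set q : R | exists (n : nat) (s : R), [/\ (0 < n)%N, K (v *+ n, s) & q = s / n%:R]].
have divU (n : nat) (t s : R) : (0 < n)%N -> (t <= s / n%:R) = (n%:R * t <= s).
  by move=> n0; rewrite ler_pdivlMr ?ltr0n // mulrC.
have [[q0 Uq0]|Uno] := pselect (U !=set0).
  have lbU (m : nat) s : (0 < m)%N -> K (- v *+ m, s) -> lbound U (- s / m%:R).
    move=> m0 Ks _ [n [u [n0 Ku ->]]]; rewrite divU // mulrA.
    rewrite ler_pdivrMr ?ltr0n //.
    by have := cross _ _ _ _ Ku Ks; rewrite -(mulr_natr u) -(mulr_natr s); lra.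
  have [lb0 lbUlb0] : exists l, lbound U l.
    move: (Uq0) => [n [u [n0 Ku _]]]; have [s] := Ksym _ _ Ku.
    by rewrite -mulNrn => Ks; exists (- s / n%:R); exact: lbU Ks.
  exists (inf U) => -[[|n]|n] s; first by move=> /Kv0; rewrite mul0r.
    rewrite -pmulrn => Ks; rewrite -pmulrn -divU //; apply: ge_inf; first by exists lb0.
    by exists n.+1, s.
  rewrite NegzE mulrNz -pmulrn -mulNrn => Ks; rewrite mulrNz -pmulrn.
  have : - s / n.+1%:R <= inf U.
    by apply: lb_le_inf; [exists q0|exact: lbU].
  by rewrite ler_pdivrMr ?ltr0n // => ?; lra.
(* The domain of [K] is symmetric, so here it contains no nonzero multiple of [v] and any slope will
   do. *)
have Unone n s : ~ K (v *+ n.+1, s).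
  by move=> Ks; apply: Uno; exists (s / n.+1%:R), n.+1, s.
exists 0 => n s; rewrite mulr0; case: n => [[|n]|n]; first exact: Kv0.
  by rewrite -pmulrn => /Unone.
by rewrite NegzE mulrNz => /Ksym[u]; rewrite opprK -pmulrn => /Unone.
Qed.

(** The sum of [K] and the subgroup generated by [(v, t)]. *)
Definition cone_adjoin K v t : set (A * R) :=
  [set p | exists (n : int) s, K (p.1 - v *~ n, s) /\ p.2 = s + n%:~R * t].

Lemma cone_adjoin_sub K v t : K `<=` cone_adjoin K v t.
Proof. by case=> a r Kar; exists 0, r; rewrite mulr0z subr0 mul0r addr0. Qed.

Lemma cone_adjoin_mem K v t n : K (0, 0) -> cone_adjoin K v t (v *~ n, n%:~R * t).
Proof. by move=> K0; exists n, 0; rewrite subrr add0r. Qed.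

Lemma epicone_adjoin K v t : epicone K ->
  (forall (n : int) s, K (v *~ n, s) -> n%:~R * t <= s) ->
  epicone (cone_adjoin K v t).
Proof.
move=> [Kadd Kpos Ksym] tP; split.
- move=> a r b s [n [u [/= Ku ->]]] [m [w [/= Kw ->]]].
  exists (n + m), (u + w); rewrite mulrzDr; split.
    by rewrite opprD addrACA; exact: Kadd.
  by rewrite rmorphD /= mulrDl addrACA.
- move=> r [n [s [/=]]]; rewrite sub0r -mulrNz => /tP.
  by rewrite rmorphN /= mulNr => ? ->; lra.
- move=> a r [n [s [/= /Ksym[u Ku] _]]].
  exists (u - n%:~R * t), (- n), u; split => /=.
    by rewrite mulrNz -opprD.
  by rewrite rmorphN mulNr.
Qed.

(* A maximal epigraph contains a line through every [v], hence is the epigraph of a homomorphism. *)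
Lemma epicone_hom K : epicone K -> K (0, 0) ->
  exists l : A -> R, (forall a b, l (a + b) = l a + l b) /\
    (forall a r, K (a, r) -> l a <= r).
Proof.
move=> coneK K0.
(* The union of the empty chain is empty, so the empty set must satisfy the condition; a maximal
   element is shown to be nonempty afterwards. *)
pose P := [set L : set (A * R) | epicone L /\ (L !=set0 -> K `<=` L)].
have [F FP Ftot|M [[coneM KM] Mmax]] := @Zorn_bigcup _ P.
  have FK X p : F X -> X p -> K `<=` X by move=> FX Xp; exact: ((FP _ FX).2 (ex_intro _ p Xp)).
  split; last by move=> [p [X FX Xp]] q Kq; exists X => //; exact: FK FX Xp _ Kq.
  split.
  - move=> a r b s [X FX Xa] [Y FY Yb].
    have [XY|YX] := Ftot _ _ FX FY.
      by exists Y => //; have [[+ _ _] _] := FP _ FY; apply=> //; exact: XY.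
    by exists X => //; have [[+ _ _] _] := FP _ FX; apply=> //; exact: YX.
  - by move=> r [X FX X0]; have [[_ + _] _] := FP _ FX; apply.
  - move=> a r [X FX Xa]; have [[_ _ +] _] := FP _ FX.
    by move=> /(_ _ _ Xa)[s Xs]; exists s, X.
have KsubM : K `<=` M.
  have [Mne|Mempty] := pselect (M !=set0); first exact: KM Mne.
  exfalso; apply: (Mmax K); last by split=> // _ p.
  split; first by move=> p Mp; case: Mempty; exists p.
  by move=> KM'; apply: Mempty; exists (0, 0); exact: KM'.
have M0 := KsubM _ K0.
have line v : exists t, M (v, t) /\ M (- v, - t).
  have [t tP] := epicone_slope v coneM M0.
  have MM : M `<=` cone_adjoin M v t by exact: cone_adjoin_sub.
  have MM' : cone_adjoin M v t `<=` M.
    apply: contrapT => nMM'; apply: (Mmax (cone_adjoin M v t)); first by split.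
    split; first exact: epicone_adjoin.
    by move=> _; exact: subset_trans KsubM MM.
  exists t; split; apply: MM'.
    by have := @cone_adjoin_mem M v t 1 M0; rewrite mulr1z mul1r.
  by have := @cone_adjoin_mem M v t (-1) M0; rewrite mulrNz mulr1z rmorphN mulNr mul1r.
have [l lP] := choice line.
have [Madd Mpos _] := coneM.
(* Adding [(- a, - l a)] to [(a, r)] gives a point over [0], and there [M] is nonnegative. *)
have lle a r : M (a, r) -> l a <= r.
  move=> Ma; have := Madd _ _ _ _ Ma (lP a).2.
  by rewrite subrr => /Mpos; lra.
exists l; split; last by move=> a r /KsubM; exact: lle.
move=> a b; apply/le_anti/andP; split.
  by apply: lle; apply: Madd; [exact: (lP a).1|exact: (lP b).1].
have := lle _ _ (Madd _ _ _ _ (lP (a + b)).1 (lP (- b)).1).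
have lN c : l (- c) <= - l c by apply: lle; exact: (lP c).2.
by rewrite addrK; have := lN b; lra.
Qed.

(** The line through [(v, t)] is adjoined before extending. It contains [(- v, - t)], so
    [l (- v) <= - t], which is the lower bound at [v]. *)
Lemma epicone_hahn_banach K v t : epicone K -> K (0, 0) ->
  (forall (n : int) s, K (v *~ n, s) -> n%:~R * t <= s) ->
  exists l : A -> R, [/\ forall a b, l (a + b) = l a + l b,
    forall a r, K (a, r) -> l a <= r & t <= l v].
Proof.
move=> coneK K0 tP; have [|l [lD lK]] := epicone_hom (epicone_adjoin coneK tP).
  exact: cone_adjoin_sub.
exists l; split=> [//|a r Ka|]; first by apply: lK; exact: cone_adjoin_sub.
have l0 : l 0 = 0 by have := lD 0 0; rewrite addr0; lra.
have lN a : l (- a) = - l a by have := lD a (- a); rewrite subrr l0; lra.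
have := lK _ _ (@cone_adjoin_mem K v t (-1) K0).
by rewrite mulrNz mulr1z rmorphN mulNr mul1r lN; lra.
Qed.
End Cone.

(** * Mixed commutator length *)

Section MixedCommutators.
Variables (G : group) (N : G -> Prop).
Hypothesis normN : normal_subgroup N.
Local Notation "a ** b" := (gmul a b) (at level 40, left associativity).
Local Notation "1g" := (gone G).
Implicit Types (a b x y g h u v : G) (s xs ys zs : seq G) (j k m n : nat).

Lemma gmulKV a b : a ** b ** ginv b = a.
Proof. by rewrite -gmulA gmulV gmul1. Qed.

Lemma gmulVK a b : a ** ginv b ** b = a.
Proof. by rewrite -gmulA gVmul gmul1. Qed.

Lemma ginv_unique a b : a ** b = 1g -> ginv a = b.
Proof. by move=> ab; rewrite -[ginv a]gmul1 -ab gmulA gVmul g1mul. Qed.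

Lemma ginvK a : ginv (ginv a) = a.
Proof. by apply: ginv_unique; rewrite gVmul. Qed.

Lemma ginvM a b : ginv (a ** b) = ginv b ** ginv a.
Proof. by apply: ginv_unique; rewrite !gmulA gmulKV gmulV. Qed.

Lemma ginv1 : ginv 1g = 1g.
Proof. by apply: ginv_unique; rewrite gmul1. Qed.

(* Complete for group words: the normal forms are the reduced left-associated words. *)
Definition gnorm := (gmulA, ginvM, ginvK, ginv1, gmulKV, gmulVK, gmulV, gVmul, gmul1, g1mul).

Lemma nsub1 : N 1g. Proof. by case: normN. Qed.
Lemma nsubM a b : N a -> N b -> N (a ** b). Proof. by case: normN => _ + _ _; apply. Qed.
Lemma nsubV a : N a -> N (ginv a). Proof. by case: normN => _ _ + _; apply. Qed.
Lemma nsubJ g a : N a -> N (g ** a ** ginv g). Proof. by case: normN => _ _ _; apply. Qed.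
Lemma nsubX a n : N a -> N (gpow a n).
Proof. by move=> Na; elim: n => [|n IH] /=; [exact: nsub1|exact: nsubM]. Qed.

Definition all_in s := forall x, List.In x s -> N x.

Lemma all_in_cons x s : all_in (x :: s) <-> N x /\ all_in s.
Proof.
split=> [H|[Nx H] y /= [<-|] //]; last exact: H.
by split=> [|y ys]; apply: H; [left|right].
Qed.

Lemma all_in_cat s t : all_in (s ++ t) <-> all_in s /\ all_in t.
Proof.
elim: s => [|x s IH] /=; first by split=> [Nt|[_ //]]; split.
by rewrite !all_in_cons IH; tauto.
Qed.

Lemma all_in_nseq x n : N x -> all_in (nseq n x).
Proof. by move=> Nx; elim: n => //= n IH; apply/all_in_cons. Qed.

Lemma all_in_inv s : all_in s -> all_in [seq ginv x | x <- s].
Proof.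
elim: s => //= x s IH /all_in_cons[Nx /IH]; rewrite all_in_cons; split=> //.
exact: nsubV.
Qed.

Lemma all_in_pow n s : all_in s -> all_in [seq gpow x n | x <- s].
Proof.
elim: s => //= x s IH /all_in_cons[Nx /IH]; rewrite all_in_cons; split=> //.
exact: nsubX.
Qed.

Lemma gprod_cat s t : gprod (s ++ t) = gprod s ** gprod t.
Proof. by elim: s => [|x s IH] /=; rewrite ?g1mul // IH gmulA. Qed.

Lemma nsub_gprod s : all_in s -> N (gprod s).
Proof.
elim: s => [|x s IH] /=; first by move=> _; exact: nsub1.
by move=> /all_in_cons[Nx /IH]; exact: nsubM.
Qed.

Lemma gpowD x m n : gpow x (m + n) = gpow x m ** gpow x n.
Proof. by elim: m => [|m IH] /=; rewrite ?g1mul // IH gmulA. Qed.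

Lemma gpowSr x n : gpow x n.+1 = gpow x n ** x.
Proof. by rewrite -addn1 gpowD /= gmul1. Qed.

Lemma gpowJ g x n : gpow (g ** x ** ginv g) n = g ** gpow x n ** ginv g.
Proof. by elim: n => [|n IH] /=; rewrite ?IH !gnorm. Qed.

Lemma gpowV x n : gpow (ginv x) n = ginv (gpow x n).
Proof. by elim: n => [|n IH]; rewrite ?ginv1 // gpowSr IH /= ginvM. Qed.

Definition cl_le k y := exists cs : seq (G * G),
  [/\ mixed_comms N cs, (size cs <= k)%N & comm_prod cs = y].

Lemma mixed_comms_cons p (cs : seq (G * G)) :
  mixed_comms N (p :: cs) <-> N p.2 /\ mixed_comms N cs.
Proof.
split=> [H|[Nx H] y /= [<-|] //]; last exact: H.
by split=> [|y ys]; apply: H; [left|right].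
Qed.

Lemma mixed_comms_cat (cs ds : seq (G * G)) :
  mixed_comms N cs -> mixed_comms N ds -> mixed_comms N (cs ++ ds).
Proof.
elim: cs => [|p cs IH] //= /mixed_comms_cons[Np /IH H] /H.
by rewrite mixed_comms_cons.
Qed.

Lemma comm_prod_cat (cs ds : seq (G * G)) :
  comm_prod (cs ++ ds) = comm_prod cs ** comm_prod ds.
Proof. by rewrite /comm_prod map_cat gprod_cat. Qed.

Lemma cl_le_mono j k y : (j <= k)%N -> cl_le j y -> cl_le k y.
Proof. by move=> jk [cs [Ncs szcs <-]]; exists cs; split=> //; exact: leq_trans jk. Qed.

Lemma cl_le1 k : cl_le k 1g.
Proof. by exists [::]; split=> // p []. Qed.

Lemma cl_leM j k x y : cl_le j x -> cl_le k y -> cl_le (j + k) (x ** y).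
Proof.
move=> [cs [Ncs scs <-]] [ds [Nds sds <-]]; exists (cs ++ ds); split.
- exact: mixed_comms_cat.
- by rewrite size_cat leq_add.
- exact: comm_prod_cat.
Qed.

Lemma cl_le_comm g x : N x -> cl_le 1 (g ** x ** ginv g ** ginv x).
Proof.
move=> Nx; exists [:: (g, x)]; split=> //; first by move=> p [<-|].
by rewrite /comm_prod /= gmul1.
Qed.

Lemma cl_le_ind (P : nat -> G -> Prop) :
  (forall k, P k 1g) ->
  (forall k g x y, N x -> cl_le k y -> P k y -> P k.+1 (g ** x ** ginv g ** ginv x ** y)) ->
  forall k y, cl_le k y -> P k y.
Proof.
move=> P1 PS k y [cs [Ncs scs <-]]; elim: cs Ncs k scs => [|[g x] cs IH] //.
move=> /mixed_comms_cons[/= Nx Ncs] [//|k] scs.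
by apply: PS => //; [exists cs|exact: IH].
Qed.

(** Conjugating [[h, x]] by [g] gives the mixed commutator of the conjugates of [h] and [x]. *)
Lemma cl_leJ k g y : cl_le k y -> cl_le k (g ** y ** ginv g).
Proof.
move: k y; apply: cl_le_ind => [k|k h x y Nx _ IH].
  by rewrite !gnorm; exact: cl_le1.
have := cl_leM (cl_le_comm (g ** h ** ginv g) (nsubJ g Nx)) IH.
by rewrite add1n !gnorm.
Qed.

(** The inverse of [[g, x]] is the mixed commutator of [ginv g] and [g ** x ** ginv g]. *)
Lemma cl_leV k y : cl_le k y -> cl_le k (ginv y).
Proof.
move: k y; apply: cl_le_ind => [k|k g x y Nx _ IH].
  by rewrite ginv1; exact: cl_le1.
have := cl_leM IH (cl_le_comm (ginv g) (nsubJ g Nx)).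
by rewrite addn1 !gnorm.
Qed.

Lemma cl_le_nsub k y : cl_le k y -> N y.
Proof.
move: k y; apply: cl_le_ind => [_|k g x y Nx _ Ny]; first exact: nsub1.
by apply: nsubM => //; apply: nsubM; [exact: nsubJ|exact: nsubV].
Qed.

Lemma in_mixed_commP y : in_mixed_comm N y <-> exists k, cl_le k y.
Proof.
split=> [[cs [Ncs <-]]|[k [cs [Ncs _ <-]]]]; last by exists cs.
by exists (size cs), cs.
Qed.

(** A distance on [G] with values in commutator counts. It is invariant under translation on both
    sides because [cl_le] is invariant under conjugation, so errors add up along a computation. *)
Definition cl_near k x y := cl_le k (x ** ginv y).

Lemma cl_near_refl k x : cl_near k x x.
Proof. by rewrite /cl_near gmulV; exact: cl_le1. Qed.

Lemma cl_near_sym k x y : cl_near k x y -> cl_near k y x.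
Proof. by move=> /cl_leV; rewrite /cl_near !gnorm. Qed.

Lemma cl_near_trans j k y x z : cl_near j x y -> cl_near k y z -> cl_near (j + k) x z.
Proof. by move=> /cl_leM H /H; rewrite /cl_near !gnorm. Qed.

Lemma cl_near_mono j k x y : (j <= k)%N -> cl_near j x y -> cl_near k x y.
Proof. exact: cl_le_mono. Qed.

Lemma cl_nearM j k x x' y y' : cl_near j x x' -> cl_near k y y' ->
  cl_near (j + k) (x ** y) (x' ** y').
Proof.
move=> Hx /(cl_leJ x) Hy.
rewrite addnC; apply: (@cl_near_trans _ _ (x ** y')); first by rewrite /cl_near !gnorm in Hy *.
by rewrite /cl_near !gnorm in Hx *.
Qed.

Lemma cl_nearMl k g x y : cl_near k x y -> cl_near k (g ** x) (g ** y).
Proof. exact/(@cl_nearM 0)/cl_near_refl. Qed.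

Lemma cl_nearMr k g x y : cl_near k x y -> cl_near k (x ** g) (y ** g).
Proof. by move=> H; have := cl_nearM H (cl_near_refl 0 g); rewrite addn0. Qed.

Lemma cl_nearC g x : N x -> cl_near 1 (g ** x) (x ** g).
Proof. by move=> /(cl_le_comm g); rewrite /cl_near !gnorm. Qed.

Lemma cl_nearCr g x : N x -> cl_near 1 (x ** g) (g ** x).
Proof. by move=> Nx; apply/cl_near_sym/cl_nearC. Qed.

Lemma cl_nearJ g x : N x -> cl_near 1 (g ** x ** ginv g) x.
Proof. exact: cl_le_comm. Qed.

Lemma cl_le_near j k x y : cl_near j x y -> cl_le k y -> cl_le (j + k) x.
Proof. by move=> /cl_leM H /H; rewrite gmulVK. Qed.

(** The product with trivial conjugators, which stands in for [x_1^n + ... + x_m^n] up to an error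
    independent of [n]. *)
Definition powprod n s := gprod [seq gpow x n | x <- s].

Lemma powprod_cons n x s : powprod n (x :: s) = gpow x n ** powprod n s.
Proof. by []. Qed.

Lemma powprod_cat n s t : powprod n (s ++ t) = powprod n s ** powprod n t.
Proof. by rewrite /powprod map_cat gprod_cat. Qed.

Lemma powprod1 s : powprod 1 s = gprod s.
Proof. by elim: s => //= x s IH; rewrite powprod_cons IH /= gmul1. Qed.

Lemma powprod0 s : powprod 0 s = 1g.
Proof. by elim: s => //= x s IH; rewrite powprod_cons IH /= gmul1. Qed.

Lemma nsub_powprod n s : all_in s -> N (powprod n s).
Proof. by move=> Ns; apply: nsub_gprod; exact: all_in_pow. Qed.

(** Each adjacent transposition costs one commutator whatever the exponent is, so one [k] serves for
    all [n]. *)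
Lemma gprod_perm s t : Permutation s t -> all_in s ->
  exists k, forall n, cl_near k (powprod n s) (powprod n t).
Proof.
elim=> [|x s' t' _ IH|x y s'|s1 s2 s3 P12 IH1 _ IH2].
- by move=> _; exists 0%N => n; exact: cl_near_refl.
- move=> /all_in_cons[Nx /IH[k Hk]]; exists k => n.
  by rewrite !powprod_cons; exact: cl_nearMl.
- move=> /all_in_cons[Ny /all_in_cons[Nx _]]; exists 1%N => n.
  rewrite !powprod_cons !gmulA; apply: cl_nearMr; apply: cl_nearC.
  exact: nsubX.
- move=> N1; have N2 : all_in s2.
    by move=> x /(Permutation_in _ (Permutation_sym P12)); exact: N1.
  have [k1 H1] := IH1 N1; have [k2 H2] := IH2 N2; exists (k1 + k2)%N => n.
  exact: cl_near_trans.
Qed.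

Lemma powprodD s : all_in s ->
  forall m n, cl_near (size s) (powprod (m + n) s) (powprod m s ** powprod n s).
Proof.
elim: s => [|x s IH]; first by move=> _ m n; rewrite /powprod /= gmul1; exact: cl_near_refl.
move=> /all_in_cons[Nx Ns] m n /=; rewrite !powprod_cons gpowD -addn1 addnC.
have H1 := cl_nearMl (gpow x m ** gpow x n) (IH Ns m n).
rewrite addnC; apply: (cl_near_trans H1); rewrite !gmulA.
apply: cl_nearMr; rewrite -!gmulA; apply/cl_nearMl/cl_nearCr.
exact: nsubX.
Qed.

Lemma powprodV s : all_in s ->
  forall n, cl_near (size s) (powprod n [seq ginv x | x <- s]) (ginv (powprod n s)).
Proof.
elim: s => [|x s IH]; first by move=> _ n; rewrite /powprod /= ginv1; exact: cl_near_refl.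
move=> /all_in_cons[Nx Ns] n /=; rewrite !powprod_cons ginvM gpowV.
rewrite -addn1; apply: cl_near_trans (cl_nearMl _ (IH Ns n)) _.
by apply/cl_nearCr/nsubV/nsubX.
Qed.

Lemma powprodM s k : all_in s -> forall n,
  cl_near (k * size s) (powprod (k * n) s) (gpow (powprod n s) k).
Proof.
move=> Ns; elim: k => [|k IH] n; first by rewrite !mul0n powprod0; exact: cl_near_refl.
rewrite !mulSn /=; apply: cl_near_trans (powprodD Ns _ _) _.
by apply: cl_nearMl; exact: IH.
Qed.

Lemma cl_leX k y n : cl_le k y -> cl_le (n * k) (gpow y n).
Proof. by move=> Hy; elim: n => [|n IH] /=; [exact: cl_le1|rewrite mulSn; exact: cl_leM]. Qed.

(** Collecting the powers into the [n]-th power of [gprod s] costs [size s] commutators per factor,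
    and each factor has length at most [k]. This linear bound keeps scl finite. *)
Lemma cl_le_powprod s k n : all_in s -> cl_le k (gprod s) ->
  cl_le (n * (size s + k)) (powprod n s).
Proof.
move=> Ns H; have := cl_le_near (powprodM n Ns 1) (cl_leX n _ : cl_le (n * k) _).
by rewrite muln1 mulnDr; apply; rewrite powprod1.
Qed.

Lemma powprod_flatten_nseq n k s : powprod n (flatten (nseq k s)) = gpow (powprod n s) k.
Proof. by elim: k => //= k IH; rewrite powprod_cat IH. Qed.

(* One commutator turns [y^i (x y) x] into [x (x y) y^i], which uses up two factors of [(x y)^n]. *)
Lemma pair_of_pants x y j : N x -> N y ->
  cl_near j (gpow (x ** y) j.*2) (gpow x j.*2 ** gpow y j.*2).
Proof.
move=> Nx Ny.
(* For the induction, [x^i y^i] has already been collected on the left; each round absorbs two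
   factors [x y]. *)
suff H i : cl_near j (gpow x i ** gpow y i ** gpow (x ** y) j.*2)
    (gpow x (i + j.*2) ** gpow y (i + j.*2)).
  by have := H 0%N; rewrite /= !g1mul add0n.
elim: j i => [|j IH] i.
  by rewrite /= addn0 gmul1; exact: cl_near_refl.
rewrite doubleS !addnS -!addSn.
apply: (@cl_near_trans 1 j (gpow x i.+2 ** gpow y i.+2 ** gpow (x ** y) j.*2)); last exact: IH.
have Ex : gpow x i.+2 = gpow x i ** x ** x by rewrite !gpowSr.
have Ey : gpow y i.+2 = y ** gpow y i ** y by rewrite gpowSr.
rewrite Ex Ey [gpow (x ** y) _.+2]/= !gmulA; apply: cl_nearMr.
(* The quotient of the two sides is the commutator of [y^i (x y)] and [x y^-i]. *)
have swap : cl_near 1 (gpow y i ** (x ** y) ** x) (x ** (x ** y) ** gpow y i).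
  have := cl_le_comm (gpow y i ** (x ** y)) (nsubM Nx (nsubV (nsubX i Ny))).
  by rewrite /cl_near !gnorm.
have := cl_nearMr y (cl_nearMl (gpow x i) swap).
by rewrite !gmulA.
Qed.
End MixedCommutators.

(** * Stable mixed commutator length as a sublinear function on chains *)

Lemma le0_of_bounded_multiples (a C : R) : (forall n : nat, a * n%:R <= C) -> a <= 0.
Proof.
move=> H; rewrite leNgt; apply/negP => a0.
have /archi_boundP : 0 <= C / a.
  by apply: divr_ge0; [have := H 0%N; rewrite mulr0|exact: ltW].
by rewrite ltr_pdivrMr // ltNge mulrC H.
Qed.

Section Chains.
Variables (G : group) (N : G -> Prop).
Hypothesis normN : normal_subgroup N.
Local Notation "a ** b" := (gmul a b) (at level 40, left associativity).
Implicit Types (a b x y g h : G) (s t xs ys zs : seq G) (j k m n : nat) (r : R).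

Definition formal s : G -> rat := coeff [seq (1%R : rat, x) | x <- s].

Lemma coeff_cat (K : nzRingType) (c d : seq (K * G)) :
  coeff (c ++ d) = (coeff c : G -> K) + coeff d.
Proof. by apply/funext => a; rewrite /coeff big_cat. Qed.

Lemma coeff_cons (K : nzRingType) p (c : seq (K * G)) a :
  coeff (p :: c) a = (if `[< p.2 = a >] then p.1 else 0) + coeff c a.
Proof. by rewrite /coeff big_cons. Qed.

Lemma formal_cat s t : formal (s ++ t) = formal s + formal t.
Proof. by rewrite /formal map_cat coeff_cat. Qed.

Lemma formal_nil : formal [::] = 0.
Proof. by apply/funext => a; rewrite /formal /coeff big_nil. Qed.

Lemma formal_cons x s : formal (x :: s) = formal [:: x] + formal s.
Proof. by rewrite -cat1s formal_cat. Qed.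

Lemma formal_consE x s a : formal (x :: s) a = (`[< x = a >])%:R + formal s a.
Proof. by rewrite /formal /= coeff_cons /=; case: asboolP. Qed.

Lemma formal_ge0 s a : 0 <= formal s a.
Proof.
elim: s => [|x s IH]; first by rewrite formal_nil.
by rewrite formal_consE addr_ge0.
Qed.

Lemma formal_in s a : 0 < formal s a -> List.In a s.
Proof.
elim: s => [|x s IH]; first by rewrite formal_nil ltxx.
by rewrite formal_consE; case: asboolP => [->|_]; [left|rewrite add0r => /IH; right].
Qed.

(** Coefficients count occurrences faithfully, since the rationals have characteristic zero; equal
    occurrences are cancelled one at a time. *)
Lemma formal_inj s t : formal s = formal t -> Permutation s t.
Proof.
elim: s t => [|x s IH] t E.
  case: t E => [//|y t] /(congr1 (@^~ y)).
  rewrite formal_consE formal_nil; case: asboolP => // _ /eqP.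
  by rewrite eq_sym paddr_eq0 ?ler01 ?formal_ge0.
have xt : List.In x t.
  apply: formal_in; rewrite -E formal_consE; case: asboolP => // _.
  by rewrite ltr_pwDl ?ltr01 ?formal_ge0.
have [t1 [t2 Et]] := List.in_split _ _ xt.
rewrite Et; apply: Permutation_cons_app; apply: IH.
move: E; rewrite Et -[List.app _ _]/(t1 ++ x :: t2) formal_cons formal_cat (formal_cons x t2) addrCA => /addrI ->.
by rewrite -formal_cat.
Qed.

Lemma formal_flatten_nseq k s : formal (flatten (nseq k s)) = formal s *+ k.
Proof.
by elim: k => [|k IH] /=; rewrite ?formal_nil ?mulr0n // formal_cat IH mulrS.
Qed.

Lemma all_in_flatten_nseq k s : all_in N s -> all_in N (flatten (nseq k s)).
Proof. by move=> Ns; elim: k => [//|k IH] /=; apply/all_in_cat. Qed.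

(** The additive constant makes the rate [r] insensitive to errors bounded in [n]. *)
Definition lin_bound (f : nat -> G) r :=
  exists C : R, forall n, exists k, cl_le N k (f n) /\ k%:R <= r * n%:R + C.

Lemma lin_bound_ge0 f r : lin_bound f r -> 0 <= r.
Proof.
case=> C H; rewrite -oppr_le0; apply: (@le0_of_bounded_multiples _ C) => n.
have [k [_ Hk]] := H n.
by rewrite mulNr lerNl -(lerD2r C) addrC subrr (le_trans _ Hk).
Qed.

Lemma lin_bound_near (f g : nat -> G) r j : (forall n, cl_near N j (f n) (g n)) ->
  lin_bound g r -> lin_bound f r.
Proof.
move=> fg [C H]; exists (C + j%:R) => n; have [k [Hk kr]] := H n.
exists (j + k)%N; split; first exact: cl_le_near (fg n) Hk.
by rewrite natrD; lra.
Qed.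

Lemma lin_bound_mul (f g : nat -> G) r r' : lin_bound f r -> lin_bound g r' ->
  lin_bound (fun n => f n ** g n) (r + r').
Proof.
move=> [C H] [C' H']; exists (C + C') => n; have [k [Hk kr]] := H n.
have [k' [Hk' kr']] := H' n; exists (k + k')%N; split; first exact: cl_leM.
by rewrite natrD mulrDl addrACA lerD.
Qed.

Lemma lin_bound_inv f r : lin_bound f r -> lin_bound (fun n => ginv (f n)) r.
Proof.
by case=> C H; exists C => n; have [k [Hk kr]] := H n; exists k; split=> //; exact: cl_leV.
Qed.

Lemma lin_bound_conj (g f : nat -> G) r : lin_bound f r ->
  lin_bound (fun n => g n ** f n ** ginv (g n)) r.
Proof.
by case=> C H; exists C => n; have [k [Hk kr]] := H n; exists k; split=> //; exact: cl_leJ.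
Qed.

Lemma lin_bound_const f k : (forall n, cl_le N k (f n)) -> lin_bound f 0.
Proof.
by move=> H; exists k%:R => n; exists k; rewrite mul0r add0r.
Qed.

(* The integral chains [xs - ys] of [N], each paired with the upper bounds of its scl
   (roughly: [lin_bound] keeps a linear bound with a constant error, not just the limit). *)
Definition scl_cone : set ((G -> rat) * R) :=
  [set p | exists xs ys, [/\ all_in N xs, all_in N ys, p.1 = formal xs - formal ys &
     lin_bound (fun n => powprod n xs ** ginv (powprod n ys)) p.2]].

Lemma scl_cone_ge0 (a : G -> rat) r : scl_cone (a, r) -> 0 <= r.
Proof. by case=> xs [ys [_ _ _ /lin_bound_ge0]]. Qed.

Lemma scl_cone0 : scl_cone (0, 0).
Proof.
exists [::], [::]; split=> //=; first by rewrite subrr.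
by apply: (@lin_bound_const _ 0) => n; rewrite gmulV; exact: cl_le1.
Qed.

Lemma scl_coneN (a : G -> rat) r : scl_cone (a, r) -> scl_cone (- a, r).
Proof.
move=> [xs [ys [/= Nxs Nys -> B]]]; exists ys, xs; split=> //=.
  by rewrite opprB.
have := lin_bound_inv B; congr (lin_bound _ _).
by apply/funext => n; rewrite ginvM ginvK.
Qed.

Lemma scl_cone_epicone : epicone scl_cone.
Proof.
split.
- move=> a r b r' [xs [ys [/= Nxs Nys -> Bx]]] [xs' [ys' [/= Nxs' Nys' -> By]]].
  exists (xs ++ xs'), (ys ++ ys').
  split=> /=; [exact/all_in_cat|exact/all_in_cat| |].
    by rewrite !formal_cat opprD addrACA.
  have := lin_bound_mul Bx By.
  apply: (@lin_bound_near _ _ _ 1) => n; rewrite !powprod_cat ginvM.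
  set u := powprod n xs; set u' := powprod n xs'.
  set v := ginv (powprod n ys); set v' := ginv (powprod n ys').
  (* Both products agree after moving [v] past [u' ** v'], which costs one commutator as [v] lies in
     [N]. *)
  have Nv : N v by apply: nsubV => //; exact: nsub_powprod.
  rewrite -!(gmulA u); apply: cl_nearMl => //.
  by have := cl_nearC (u' ** v') Nv; rewrite !gmulA.
- by move=> r; exact: scl_cone_ge0.
- by move=> a r Kar; exists r; exact: scl_coneN.
Qed.

(** A bound for [k] copies of [zs] controls the exponents divisible by [k]. The other exponents
    differ from these by less than [k], which changes only the constant because [gprod zs] has
    finite length. *)
Lemma scl_cone_scale zs k r : all_in N zs -> in_mixed_comm N (gprod zs) ->
  (0 < k)%N ->   scl_cone (formal zs *+ k, r) -> lin_bound (fun n => powprod n zs) (r / k%:R).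
Proof.
move=> Nzs /in_mixed_commP[w Hw] k0 Kr; have r0 := scl_cone_ge0 Kr; move: Kr.
move=> [xs [ys [/= Nxs Nys E B]]].
have Nzsk : all_in N (flatten (nseq k zs)) by exact: all_in_flatten_nseq.
have P : Permutation xs (ys ++ flatten (nseq k zs)).
  by apply: formal_inj; rewrite formal_cat formal_flatten_nseq E addrC subrK.
have [j Hj] := gprod_perm normN P Nxs.
(* Conjugating by the [ys]-part cancels it and leaves the [k]-th power of [powprod n zs]. *)
have {}B : lin_bound (fun n => powprod (k * n) zs) r.
  apply: (@lin_bound_near _ (fun n => gpow (powprod n zs) k) _ (k * size zs)).
    by move=> n; exact: powprodM.
  have := lin_bound_conj (fun n => ginv (powprod n ys)) B.
  apply: (@lin_bound_near _ _ _ j) => n.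
  have := cl_near_sym normN (cl_nearMl normN (ginv (powprod n ys)) (Hj n)).
  by rewrite powprod_cat powprod_flatten_nseq ginvK !gnorm.
have [C BC] := B.
(* The constant pays for splitting [n] into [n %% k] and [k * (n %/ k)], and for the remainder. *)
exists (C + (size zs + k * (size zs + w))%:R) => n.
have [q [Hq qr]] := BC (n %/ k)%N.
exists (size zs + (k * (size zs + w) + q))%N; split.
  have {1}-> : n = (n %% k + k * (n %/ k))%N by rewrite addnC mulnC -divn_eq.
  apply: (cl_le_near (powprodD normN Nzs _ _)); apply: cl_leM => //.
  apply: cl_le_mono (cl_le_powprod normN _ Nzs Hw).
  by rewrite leq_mul2r ltnW ?ltn_pmod ?orbT.
rewrite addnA natrD addrA [leRHS]addrC lerD2l (le_trans qr) // lerD2r.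
rewrite -mulrA ler_wpM2l // ler_pdivlMl ?ltr0n //.
by rewrite -natrM ler_nat mulnC leq_divM.
Qed.
End Chains.

(** * Duality for lists *)

Lemma limn_R_eq (u : nat -> R) (t : R) :
  (forall e : R, 0 < e -> \forall n \near \oo, `|u n - t| <= e) -> limn u = t.
Proof.
move=> H; apply: (@cvg_lim R^o); first exact: Rhausdorff.
exact/(@cvgrPdistC_le _ R^o).
Qed.

Section Duality.
Variables (G : group) (N : G -> Prop).
Hypothesis normN : normal_subgroup N.
Local Notation "a ** b" := (gmul a b) (at level 40, left associativity).
Local Notation "1g" := (gone G).
Implicit Types (a b x y g h : G) (s xs ys zs : seq G) (j k m n : nat) (r t D : R)
  (mu : G -> R).

Lemma gpow1 n : gpow 1g n = 1g.
Proof. by elim: n => //= n ->; rewrite gmul1. Qed.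

Lemma gpowM x m n : gpow x (m * n) = gpow (gpow x m) n.
Proof. by rewrite mulnC; elim: n => //= n IH; rewrite mulSn gpowD IH. Qed.

(** Even exponents cost [n./2] commutators; an odd exponent leaves one more factor [x y], whose [x]
    is moved into place by one further commutator. *)
Lemma lin_bound_mulpow x y : N x -> N y ->
  lin_bound N (fun n => gpow (x ** y) n ** ginv (gpow x n ** gpow y n)) 2^-1.
Proof.
move=> Nx Ny; exists 1 => n; exists (n./2 + 1)%N; split; last first.
  rewrite natrD lerD2r ler_pdivlMl ?ltr0n // -natrM ler_nat mul2n.
  by rewrite -[leqRHS]odd_double_half leq_addl.
have H := pair_of_pants normN n./2 Nx Ny.
case: (boolP (odd n)) => nodd; last first.
  by apply: cl_le_mono (leq_addr _ _) _; rewrite -{2 3 4}(even_halfK nodd).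
have -> : gpow (x ** y) n = gpow (x ** y) n./2.*2 ** (x ** y).
  by rewrite -gpowSr odd_halfK // prednK // odd_gt0.
have -> : gpow x n = gpow x n./2.*2 ** x.
  by rewrite -gpowSr odd_halfK // prednK // odd_gt0.
have -> : gpow y n = gpow y n./2.*2 ** y.
  by rewrite -gpowSr odd_halfK // prednK // odd_gt0.
set u := gpow x _ in H *; set v := gpow y _ in H *.
apply: (@cl_near_trans _ _ _ _ (u ** v ** (x ** y))); first exact: cl_nearMr.
rewrite !gmulA; apply: cl_nearMr => //; rewrite -!gmulA; apply: cl_nearMl => //.
exact: cl_nearC.
Qed.

(* A functional bounded by scl has defect at most [1/2], since [scl (x y - x - y) <= 1/2]. *)
Lemma extremal_quasimorphism zs t : all_in N zs -> 0 <= t ->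
  (forall k r, (0 < k)%N -> scl_cone N (formal zs *+ k, r) -> k%:R * t <= r) ->
  exists mu, [/\ in_QNG N mu,
    forall h1 h2, N h1 -> N h2 -> `|mu (h1 ** h2) - mu h1 - mu h2| <= 2^-1 &
    t <= \sum_(z <- zs) mu z].
Proof.
move=> Nzs t0 tP.
have [|l [lD lK lt]] :=
    @epicone_hahn_banach _ _ (formal zs) t (scl_cone_epicone normN) (scl_cone0 N).
  (* Negative multiples impose nothing new: heights in the cone are nonnegative and so is [t]. *)
  move=> [[|k]|k] s.
  - by rewrite mulr0z mul0r; exact: scl_cone_ge0.
  - by rewrite -!pmulrn; exact: tP.
  - move=> /scl_cone_ge0; apply: le_trans.
    by rewrite NegzE mulrNz mulNr oppr_le0 mulr_ge0 // -pmulrn.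
have l0 : l 0 = 0 by have := lD 0 0; rewrite addr0; lra.
have lN (f : G -> rat) : l (- f) = - l f by have := lD f (- f); rewrite subrr l0; lra.
have labs xs ys r : all_in N xs -> all_in N ys ->
    lin_bound N (fun n => powprod n xs ** ginv (powprod n ys)) r ->
    `|l (formal xs) - l (formal ys)| <= r.
  move=> Nxs Nys B; rewrite -lN -lD ler_norml lerNl -lN.
  have K : scl_cone N (formal xs - formal ys, r) by exists xs, ys.
  by rewrite !lK //; exact: scl_coneN.
pose mu x := l (formal [:: x]).
have N1 x : N x -> all_in N [:: x] by move=> Nx y [<-|[]].
have N2 x y : N x -> N y -> all_in N [:: x; y].
  by move=> Nx Ny z [<-|[<-|[]]].
have mu2 x y r : N x -> N y ->
    lin_bound N (fun n => gpow (x ** y) n ** ginv (gpow x n ** gpow y n)) r ->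
    `|mu (x ** y) - mu x - mu y| <= r.
  move=> Nx Ny B; rewrite -addrA -opprD -lD -formal_cons.
  apply: labs; [by apply: N1; exact: nsubM|exact: N2|].
  by move: B; congr (lin_bound _ _ _); apply/funext => n; rewrite /powprod /= !gmul1.
(* When powers multiply exactly the error has rate [0]. This covers powers of a single element and
   yields homogeneity. *)
have muM x y : N x -> N y -> (forall n, gpow (x ** y) n = gpow x n ** gpow y n) ->
    mu (x ** y) = mu x + mu y.
  move=> Nx Ny xy; have : `|mu (x ** y) - mu x - mu y| <= 0.
    apply: mu2 => //; apply: (@lin_bound_const _ _ _ 0) => n.
    by rewrite xy gmulV; exact: cl_le1.
  by rewrite normr_le0 => /eqP; lra.
have mu1 : mu 1g = 0.
  have : mu (1g ** 1g) = mu 1g + mu 1g.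
    by apply: muM; [exact: nsub1|exact: nsub1|move=> n; rewrite gmul1 gpow1 gmul1].
  by rewrite gmul1; lra.
have muV x : N x -> mu (ginv x) = - mu x.
  move=> Nx; have : mu (x ** ginv x) = mu x + mu (ginv x).
    by apply: muM => // [|n]; [exact: nsubV|rewrite gmulV gpow1 gpowV gmulV].
  by rewrite gmulV mu1; lra.
exists mu; split; last first.
- suff -> : \sum_(z <- zs) mu z = l (formal zs) by [].
  elim: (zs) => [|z s IH]; first by rewrite big_nil formal_nil l0.
  by rewrite big_cons formal_cons lD IH.
- by move=> x y Nx Ny; apply: mu2 => //; exact: lin_bound_mulpow.
split.
- exists 2^-1 => x y Nx Ny; apply: mu2 => //; exact: lin_bound_mulpow.
- have muX x n : N x -> mu (gpow x n) = n%:R * mu x.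
    move=> Nx; elim: n => [|n IH]; first by rewrite mu1 mul0r.
    rewrite /= muM // ?IH; first by rewrite -natr1; lra.
      exact: nsubX.
    by move=> m; rewrite -[x ** _]/(gpow x n.+1) -!gpowM mulSn gpowD.
  move=> x [n|n] Nx; first by rewrite muX.
  have Nxn : N (gpow x n.+1) by exact: nsubX.
  by rewrite -[gpowz _ _]/(ginv (gpow x n.+1)) muV // muX // NegzE mulrNz mulNr.
(* The [n]-th powers of [x] and of its conjugate differ by the single commutator [[g, x^n]], so the
   rate is [0]. *)
- move=> g x Nx; have : `|l (formal [:: g ** x ** ginv g]) - l (formal [:: x])| <= 0.
    apply: labs; [by apply: N1; exact: nsubJ|exact: N1|].
    apply: (@lin_bound_const _ _ _ 1) => n; rewrite /powprod /= !gmul1 gpowJ.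
    by apply: cl_le_comm; exact: nsubX.
  by rewrite normr_le0 => /eqP; rewrite /mu; lra.
Qed.

Lemma quasimorphism1 mu : in_QNG N mu -> mu 1g = 0.
Proof. by case=> _ /(_ 1g 0 (nsub1 normN)) /= -> _; rewrite mul0r. Qed.

Lemma quasimorphismX mu x n : in_QNG N mu -> N x -> mu (gpow x n) = n%:R * mu x.
Proof. by case=> _ /(_ x n) /= H _ /H. Qed.

Lemma quasimorphismV mu x : in_QNG N mu -> N x -> mu (ginv x) = - mu x.
Proof. by case=> _ /(_ x (-1)) /= H _ /H; rewrite gmul1 mulN1r. Qed.

Section Bounds.
Variables (mu : G -> R) (D : R).
Hypothesis QNGmu : in_QNG N mu.
Hypothesis muD : forall h1 h2, N h1 -> N h2 -> `|mu (h1 ** h2) - mu h1 - mu h2| <= D.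

(** In [mu [g, x]] the terms from [g x g^-1] and [x^-1] cancel by invariance, leaving an error [D];
    multiplying by the remaining product costs another [D]. *)
Lemma quasimorphism_cl k y : cl_le N k y -> `|mu y| <= 2 * D * k%:R.
Proof.
have D0 : 0 <= D by apply: le_trans (muD (nsub1 normN) (nsub1 normN)).
move: k y; apply: cl_le_ind => [k|k g x y Nx Hy IH].
  by rewrite quasimorphism1 // normr0 !mulr_ge0.
have NJ := nsubJ normN g Nx; have NV := nsubV normN Nx.
have Ny := cl_le_nsub normN Hy.
have := muD NJ NV; rewrite quasimorphismV //.
have [_ _ /(_ g x Nx) ->] := QNGmu; rewrite opprK subrK => H1.
have := muD (nsubM normN NJ NV) Ny; move: H1 IH; rewrite -[k.+1%:R]natr1 mulrDr mulr1.
by rewrite !ler_norml => /andP[? ?] /andP[? ?] /andP[? ?]; apply/andP; split; lra.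
Qed.

Lemma quasimorphism_gprod zs n : all_in N zs ->
  `|mu (powprod n zs) - n%:R * \sum_(z <- zs) mu z| <= D * (size zs)%:R.
Proof.
elim: zs => [|z zs IH] => [_|/all_in_cons[Nz Nzs]].
  by rewrite big_nil mulr0 subr0 quasimorphism1 // normr0 mulr0.
have := muD (nsubX normN n Nz) (nsub_powprod normN n Nzs).
rewrite -powprod_cons quasimorphismX // big_cons mulrDr [size _]/=.
rewrite -[(size zs).+1%:R]natr1 mulrDr mulr1.
move: (IH Nzs); rewrite !ler_norml => /andP[? ?] /andP[? ?]; apply/andP; split; lra.
Qed.

Lemma quasimorphism_powprod zs n k : all_in N zs -> cl_le N k (powprod n zs) ->
  n%:R * `|\sum_(z <- zs) mu z| <= D * (2 * k%:R + (size zs)%:R).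
Proof.
move=> /(quasimorphism_gprod n) H1 /quasimorphism_cl H2.
rewrite -[X in X * _]ger0_norm // -normrM mulrDr.
move: H1 H2; rewrite !ler_norml => /andP[? ?] /andP[? ?]; apply/andP; split; lra.
Qed.
End Bounds.

Lemma twisted_prod_near xs gs : all_in N xs -> size gs = (size xs).-1 ->
  cl_near N (size xs) (gprod xs) (twisted_prod xs gs).
Proof.
case: xs => [|x xs]; first by move=> _ _; exact: cl_near_refl.
move=> /all_in_cons[_ Nxs] /= sz; apply: cl_nearMl => //.
apply: (cl_near_mono (leqnSn _)).
elim: xs gs sz Nxs => [|y xs IH] [|g gs] //=; first by move=> *; exact: cl_near_refl.
move=> [sz] /all_in_cons[Ny Nxs]; rewrite -add1n; apply: cl_nearM => //; last exact: IH.
by apply: cl_near_sym => //; exact: cl_nearJ.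
Qed.

Lemma cl_list_le xs k : cl_le N k (gprod xs) -> cl_list N xs <= k%:R.
Proof.
move=> [cs [Ncs szcs csE]].
apply: (@le_trans _ _ (size cs)%:R); last by rewrite ler_nat.
apply: ge_inf; first by exists 0 => _ [gs [ds [_ _ _ ->]]].
exists (nseq (size xs).-1 1g), cs; rewrite size_nseq csE; split=> //.
case: xs {csE} => //= x xs; congr (_ ** _).
by elim: xs => //= y xs ->; rewrite g1mul ginv1 gmul1.
Qed.

Lemma cl_list_ge xs r : all_in N xs -> in_mixed_comm N (gprod xs) ->
  (forall k, cl_le N k (gprod xs) -> r <= k%:R) -> r - (size xs)%:R <= cl_list N xs.
Proof.
move=> Nxs [cs [Ncs csE]] H; apply: lb_le_inf.
  (* The infimum of an empty set would be a default value, so a factorization is exhibited, with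
     trivial conjugators. *)
  have szn : size (nseq (size xs).-1 1g) = (size xs).-1 by rewrite size_nseq.
  have [ds [Nds _ dsE]] : cl_le N (size xs + size cs) (twisted_prod xs (nseq (size xs).-1 1g)).
    apply: (cl_le_near (cl_near_sym normN (twisted_prod_near Nxs szn))).
    by exists cs.
  by exists (size ds)%:R, (nseq (size xs).-1 1g), ds.
move=> _ [gs [ds [sz Nds dsE ->]]]; rewrite lerBlDl -natrD; apply: H.
by apply: (cl_le_near (twisted_prod_near Nxs sz)); exists ds.
Qed.

Lemma in_mixed_comm_powprod zs n : all_in N zs -> in_mixed_comm N (gprod zs) ->
  in_mixed_comm N (powprod n zs).
Proof.
move=> Nzs /in_mixed_commP[k Hk]; apply/in_mixed_commP.
by exists (n * (size zs + k))%N; exact: cl_le_powprod.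
Qed.

Lemma scl_list_eq zs (t C : R) : all_in N zs -> in_mixed_comm N (gprod zs) ->
  (forall n k, cl_le N k (powprod n zs) -> n%:R * t <= k%:R + C) ->
  (forall e, 0 < e -> lin_bound N (fun n => powprod n zs) (t + e)) ->
  scl_list N zs = t.
Proof.
move=> Nzs Mzs lo up; apply: limn_R_eq => e e0.
have e2 : 0 < e / 2 by rewrite divr_gt0.
have [C' HC'] := up _ e2.
pose M := `|C| + (size zs)%:R + `|C'|.
(* Beyond this index the constant errors are at most [n * (e / 2)]; the other half of [e] is the
   slack in the rate. *)
exists (Num.bound (M / (e / 2))).+1 => // n /= Mn.
have n0 : 0 < n%:R :> R by rewrite ltr0n (leq_trans _ Mn).
have : M <= n%:R * (e / 2).
  rewrite -ler_pdivrMr // ltW // (lt_le_trans (archi_boundP _)) ?divr_ge0 ?addr_ge0 //.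
    exact: ltW.
  by rewrite ler_nat ltnW.
rewrite /M => Me.
have := ler_norm C; have := ler_norm C'; have := normr_ge0 C; have := normr_ge0 C'.
have s0 : (0 : R) <= (size zs)%:R by [].
have ne0 : 0 < n%:R * (e / 2) by rewrite mulr_gt0.
move=> c1 c2 c3 c4.
rewrite ler_distl; apply/andP; split.
  rewrite ler_pdivlMr //.
  have Nn : all_in N [seq gpow x n | x <- zs] by exact: all_in_pow.
  have Mn' : in_mixed_comm N (gprod [seq gpow x n | x <- zs]) by exact: in_mixed_comm_powprod.
  apply: le_trans (cl_list_ge (r := n%:R * t - C) Nn Mn' _) => [|k /lo]; last by rewrite lerBlDr.
  by rewrite size_map; lra.
have [k [Hk kr]] := HC' n; rewrite ler_pdivrMr //.
apply: le_trans (cl_list_le Hk) (le_trans kr _).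
by rewrite !mulrDl; lra.
Qed.

(** Both parts compare scl with the best rate [t] obtained from multiples of [zs]. Hahn-Banach
    provides an extremal [mu] for [t], and [mu] in turn bounds the lengths from below, so the limit
    exists and equals [t]. *)
Lemma scl_list_bavard zs : all_in N zs -> in_mixed_comm N (gprod zs) ->
  (forall mu D, in_QNG N mu ->
    (forall h1 h2, N h1 -> N h2 -> `|mu (h1 ** h2) - mu h1 - mu h2| <= D) ->
    `|\sum_(z <- zs) mu z| <= 2 * D * scl_list N zs) /\
  exists mu, [/\ in_QNG N mu,
    forall h1 h2, N h1 -> N h2 -> `|mu (h1 ** h2) - mu h1 - mu h2| <= 2^-1 &
    scl_list N zs <= \sum_(z <- zs) mu z].
Proof.
move=> Nzs Mzs.
pose T := [set q : R | exists k r, [/\ (0 < k)%N, scl_cone N (formal zs *+ k, r) & q = r / k%:R]].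
have T0 : lbound T 0.
  by move=> _ [k [r [k0 /scl_cone_ge0 r0 ->]]]; rewrite divr_ge0.
have Tne : T !=set0.
  have [w Hw] := (in_mixed_commP N _).1 Mzs.
  exists ((size zs + w)%:R / 1), 1%N, (size zs + w)%:R; split=> //.
  rewrite mulr1n; exists zs, [::]; split=> //=; first by rewrite formal_nil subr0.
  exists 0 => n; exists (n * (size zs + w))%N.
  rewrite /powprod /= ginv1 gmul1 addr0 -natrM mulnC; split=> //.
  by rewrite mulnC; exact: cl_le_powprod.
pose t := inf T.
have t0 : 0 <= t by exact: lb_le_inf.
have [|mu [QNGmu muD tmu]] := extremal_quasimorphism Nzs t0.
  move=> k r k0 Kr; rewrite mulrC -ler_pdivlMr ?ltr0n //.
  by apply: ge_inf; [exists 0|exists k, r].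
have up e : 0 < e -> lin_bound N (fun n => powprod n zs) (t + e).
  move=> e0; have [|_ [k [r [k0 Kr ->]]] rt] := @inf_adherent _ T e e0.
    by split=> //; exists 0.
  have [C HC] := scl_cone_scale normN Nzs Mzs k0 Kr.
  exists C => n; have [j [Hj jr]] := HC n; exists j; split=> //.
  by apply: (le_trans jr); rewrite lerD2r ler_wpM2r // ltW.
have sclE : scl_list N zs = t.
  (* With defect bound [2^-1] the estimate reads [n t <= k + size / 2], which explains the
     constant. *)
  apply: (@scl_list_eq _ _ (2^-1 * (size zs)%:R)) => // n k Hk.
  have := quasimorphism_powprod QNGmu muD Nzs Hk.
  have : n%:R * t <= n%:R * `|\sum_(z <- zs) mu z|.
    by rewrite ler_wpM2l // (le_trans tmu) // ler_norm.
  by lra.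
rewrite sclE; split; last by exists mu.
move=> nu D QNGnu nuD.
have D0 : 0 <= D by apply: le_trans (nuD _ _ (nsub1 normN) (nsub1 normN)).
(* The slack is divided by [2 * D + 1] rather than [2 * D], since [D] may vanish. *)
apply/ler_addgt0Pr => e e0; have D1 : 0 < 2 * D + 1 by lra.
have [C HC] := up (e / (2 * D + 1)) (divr_gt0 e0 D1).
rewrite -subr_le0; apply: (@le0_of_bounded_multiples _ (D * (2 * C + (size zs)%:R))) => n.
have [k [Hk kr]] := HC n.
have := quasimorphism_powprod QNGnu nuD Nzs Hk.
have : D * (2 * k%:R) <= D * (2 * ((t + e / (2 * D + 1)) * n%:R + C)).
  by rewrite ler_wpM2l // ler_wpM2l.
have : 2 * D * (e / (2 * D + 1)) * n%:R <= e * n%:R.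
  rewrite ler_wpM2r // mulrA ler_pdivrMr // mulrC ler_wpM2l ?(ltW e0) //; lra.
by set q := e / _; lra.
Qed.
End Duality.

(** * Rational chains *)

Section IntegralRepresentation.
Variables (G : group) (N : G -> Prop).
Hypothesis normN : normal_subgroup N.
Local Notation "a ** b" := (gmul a b) (at level 40, left associativity).
Local Notation "1g" := (gone G).
Implicit Types (a b x y g h : G) (s xs ys zs : seq G) (k m n : nat) (mu : G -> R).

Lemma coeff_scale (q : rat) (c : seq (rat * G)) a :
  coeff [seq (q * p.1, p.2) | p <- c] a = q * coeff c a.
Proof.
rewrite /coeff big_map mulr_sumr; apply: eq_bigr => p _ /=.
by case: asboolP; rewrite ?mulr0.
Qed.

Lemma coeff_opp s : coeff [seq (-1 : rat, y) | y <- s] = - formal s.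
Proof.
apply/funext => a; rewrite -[RHS]/(- formal s a) /formal /coeff !big_map -sumrN.
apply: eq_bigr => y _ /=.
by case: asboolP; rewrite ?oppr0.
Qed.

(** All terms sharing the generator of the head are removed at once: together they contribute the
    coefficient zero, and a shorter list remains. *)
Lemma eval_chain_coeff0 mu (c : seq (rat * G)) :
  (forall a, coeff c a = 0) -> eval_chain mu c = 0.
Proof.
have [n] := ubnP (size c); elim: n c => // n IH [|p c] szc c0.
  by rewrite /eval_chain big_nil.
pose isp := fun q : rat * G => `[< q.2 = p.2 >].
rewrite /eval_chain (bigID isp) /= addrC -big_filter.
have -> : \sum_(q <- [seq q <- p :: c | ~~ isp q]) ratr q.1 * mu q.2 = 0.
  apply: IH => [|a].
    by rewrite /= /isp asboolT //= size_filter (leq_ltn_trans (count_size _ _)).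
  rewrite /coeff big_filter; have [->|ap] := pselect (a = p.2).
    by apply: big1 => q; rewrite /isp; case: asboolP.
  rewrite -[RHS](c0 a) /coeff [RHS](bigID isp) /= [X in _ = X + _]big1 ?add0r //.
  by move=> q; rewrite /isp => /asboolP ->; case: asboolP => // E; case: ap.
rewrite add0r; transitivity (ratr (coeff (p :: c) p.2) * mu p.2); last first.
  by rewrite c0 rmorph0 mul0r.
rewrite /coeff raddf_sum mulr_suml [RHS](bigID isp) /= [X in _ = _ + X]big1 ?addr0.
  apply: eq_bigr => q; rewrite /isp => qp.
  by rewrite qp; move/asboolP: qp => ->.
by move=> q; rewrite /isp; case: asboolP => // _ _; rewrite rmorph0 mul0r.
Qed.

Lemma eval_chain_cat mu (c d : seq (rat * G)) :
  eval_chain mu (c ++ d) = eval_chain mu c + eval_chain mu d.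
Proof. by rewrite /eval_chain big_cat. Qed.

Lemma eval_chain_scale mu (q : rat) (c : seq (rat * G)) :
  eval_chain mu [seq (q * p.1, p.2) | p <- c] = ratr q * eval_chain mu c.
Proof.
rewrite /eval_chain big_map mulr_sumr; apply: eq_bigr => p _ /=.
by rewrite rmorphM mulrA.
Qed.

Lemma eval_chain_eq mu (c d : seq (rat * G)) :
  chain_eq c d -> eval_chain mu c = eval_chain mu d.
Proof.
move=> cd; apply/eqP; rewrite -subr_eq0; apply/eqP.
transitivity (eval_chain mu (c ++ [seq (-1 * p.1, p.2) | p <- d])).
  by rewrite eval_chain_cat eval_chain_scale rmorphN1 mulN1r.
apply: eval_chain_coeff0 => a.
by rewrite coeff_cat -[LHS]/(coeff c a + coeff _ a) coeff_scale cd mulN1r subrr.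
Qed.

(** A section of [G -> G / N], normalized to be trivial on [N] so that [coset_part] is the identity
    there. *)
Definition coset_rep g : G :=
  if `[< N g >] then 1g else ClassicalEpsilon.epsilon (inhabits 1g) (fun h => N (ginv h ** g)).

Definition coset_part g : G := ginv (coset_rep g) ** g.

Lemma nsubMr_iff g x : N x -> N (g ** x) <-> N g.
Proof.
move=> Nx; split=> [H|Ng]; last exact: nsubM.
by have := nsubM normN H (nsubV normN Nx); rewrite gmulKV.
Qed.

(** The predicate given to [epsilon] depends only on the coset of [g], hence so does the chosen
    element. *)
Lemma coset_repM g x : N x -> coset_rep (g ** x) = coset_rep g.
Proof.
move=> Nx; rewrite /coset_rep.
have -> : N (g ** x) = N g by apply/propext; exact: nsubMr_iff.
congr (if _ then _ else ClassicalEpsilon.epsilon _ _).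
by apply/funext => h; apply/propext; rewrite gmulA; exact: nsubMr_iff.
Qed.

Lemma nsub_coset_part g : N (coset_part g).
Proof.
rewrite /coset_part /coset_rep; case: asboolP => [Ng|_].
  by rewrite ginv1 g1mul.
apply: (@ClassicalEpsilon.epsilon_spec _ (inhabits 1g) (fun h => N (ginv h ** g))).
by exists g; rewrite gVmul; exact: nsub1.
Qed.

Lemma coset_part_id x : N x -> coset_part x = x.
Proof. by move=> Nx; rewrite /coset_part /coset_rep asboolT // ginv1 g1mul. Qed.

(** A factor in [N] does not change the coset representative, possibly after being moved to the
    right of the other factor by conjugation; the two orders then differ by one commutator. *)
Lemma coset_partM g1 g2 : N g1 \/ N g2 ->
  exists k, cl_near N k (coset_part g2 ** coset_part g1) (coset_part (g1 ** g2)).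
Proof.
case=> Ng.
  exists 1%N; rewrite (coset_part_id Ng).
  have NJ := nsubJ normN (ginv g2) Ng.
  have -> : g1 ** g2 = g2 ** (ginv g2 ** g1 ** ginv (ginv g2)) by rewrite !gnorm.
  rewrite /coset_part coset_repM // (gmulA _ g2).
  by apply: cl_nearMl => //; apply: cl_near_sym => //; exact: cl_nearJ.
exists 1%N; rewrite (coset_part_id Ng).
have -> : coset_part (g1 ** g2) = coset_part g1 ** g2.
  by rewrite /coset_part coset_repM // gmulA.
exact: cl_nearCr.
Qed.

Definition part_prod s := gprod [seq coset_part g | g <- s].

Lemma part_prod_cat s t : part_prod (s ++ t) = part_prod s ** part_prod t.
Proof. by rewrite /part_prod map_cat gprod_cat. Qed.

Lemma all_in_coset_part s : all_in N [seq coset_part g | g <- s].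
Proof.
elim: s => [//|g s IH] /=; apply/all_in_cons; split=> //; exact: nsub_coset_part.
Qed.

Lemma part_prod_id s : all_in N s -> part_prod s = gprod s.
Proof.
elim: s => //= x s IH /all_in_cons[Nx /IH E].
by rewrite /part_prod /= -/(part_prod s) E coset_part_id.
Qed.

(* The integral chains killed by the extension of [N -> N / [G, N]] to [G] along a section of [G -> G / N];
   this extension is additive on the pairs allowed in [C'_2]. *)
Definition part_kernel (f : G -> rat) := exists xs ys,
  f = formal xs - formal ys /\ exists k, cl_near N k (part_prod xs) (part_prod ys).

Lemma part_kernelD f f' : part_kernel f -> part_kernel f' -> part_kernel (f + f').
Proof.
move=> [xs [ys [-> [k Hk]]]] [xs' [ys' [-> [k' Hk']]]].
exists (xs ++ xs'), (ys ++ ys'); split.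
  by rewrite !formal_cat opprD addrACA.
by exists (k + k')%N; rewrite !part_prod_cat; exact: cl_nearM.
Qed.

Lemma part_kernelN f : part_kernel f -> part_kernel (- f).
Proof.
move=> [xs [ys [-> [k Hk]]]]; exists ys, xs; rewrite opprB; split=> //.
by exists k; exact: cl_near_sym.
Qed.

Lemma part_kernel0 : part_kernel 0.
Proof.
by exists [::], [::]; rewrite subrr; split=> //; exists 0%N; exact: cl_near_refl.
Qed.

Lemma part_kernelZ (z : int) f : part_kernel f -> part_kernel (fun a => z%:~R * f a).
Proof.
move=> Hf; have Hn n : part_kernel (fun a => n%:R * f a).
  elim: n => [|n IH].
    by have := part_kernel0; congr part_kernel; apply/funext => a; rewrite mul0r.
  have := part_kernelD Hf IH; congr part_kernel; apply/funext => a.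
  by rewrite mulrS mulrDl mul1r.
case: z => n; first exact: Hn.
have := part_kernelN (Hn n.+1); congr part_kernel; apply/funext => a.
by rewrite NegzE mulrNz mulNr.
Qed.

Lemma part_kernel_bd g1 g2 : N g1 \/ N g2 ->
  part_kernel (formal [:: g2; g1] - formal [:: g1 ** g2]).
Proof.
move=> /coset_partM[k Hk]; exists [:: g2; g1], [:: g1 ** g2]; split=> //.
by exists k; rewrite /part_prod /= !gmul1.
Qed.

(** Two presentations of the same function become permutations of each other after adding the
    opposite negative parts, and permuting costs only commutators in [N]. *)
Lemma part_kernel_near xs ys : part_kernel (formal xs - formal ys) ->
  exists k, cl_near N k (part_prod xs) (part_prod ys).
Proof.
move=> [xs' [ys' [E [k Hk]]]].
have P : Permutation (xs ++ ys') (ys ++ xs').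
  have Exs : formal xs = formal xs' - formal ys' + formal ys by rewrite -E subrK.
  by apply: formal_inj; rewrite !formal_cat Exs addrAC subrK addrC.
have NP : all_in N [seq coset_part g | g <- xs ++ ys'] by exact: all_in_coset_part.
have [j Hj] := gprod_perm normN (Permutation_map coset_part P) NP.
have {}Hj : cl_near N j (part_prod xs ** part_prod ys') (part_prod ys ** part_prod xs').
  by have := Hj 1%N; rewrite !powprod1 -!part_prod_cat.
have := cl_near_trans Hj (cl_nearMl normN (part_prod ys) Hk).
move=> /(cl_nearMr normN (ginv (part_prod ys'))); rewrite !gmulKV.
by exists (j + k)%N.
Qed.

Lemma common_denominator (s : seq rat) : exists m, (0 < m)%N /\
  forall q, q \in s -> exists z : int, m%:R * q = z%:~R.
Proof.
elim: s => [|q s [m [m0 Hm]]]; first by exists 1%N.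
exists (`|denq q| * m)%N; split; first by rewrite muln_gt0 m0 absz_gt0 denq_neq0.
move=> q'; rewrite inE => /orP[/eqP ->|/Hm[z Hz]].
  exists (m%:Z * numq q); rewrite mulnC natrM -mulrA rmorphM.
  by rewrite [_ * q]mulrC [`|_|%:R]pmulrn absz_denq -numqE.
by exists (`|denq q|%:Z * z); rewrite natrM -mulrA Hz rmorphM.
Qed.

Lemma part_kernel_bd2 m (d : seq (rat * (G * G))) :
  (forall p, List.In p d -> N p.2.1 \/ N p.2.2) ->
  (forall q, q \in [seq p.1 | p <- d] -> exists z : int, m%:R * q = z%:~R) ->
  part_kernel (fun a => m%:R * coeff (bd2 d) a).
Proof.
elim: d => [|[q [g1 g2]] d IH] Nd Hm.
  have := part_kernel0; congr part_kernel; apply/funext => a.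
  by rewrite /bd2 /= /coeff big_nil mulr0.
have [|z Hz] := Hm q; first by rewrite inE eqxx.
have H1 := part_kernelZ z (part_kernel_bd (Nd _ (or_introl erefl))).
have H2 : part_kernel (fun a => m%:R * coeff (bd2 d) a).
  by apply: IH => [p pd|q' q'd]; [apply: Nd; right|apply: Hm; rewrite inE q'd orbT].
have := part_kernelD H1 H2; congr part_kernel; apply/funext => a.
rewrite -[bd2 (_ :: d)]/([:: (q, g2); (- q, g1 ** g2); (q, g1)] ++ bd2 d) coeff_cat.
rewrite -[LHS]/(z%:~R * (formal [:: g2; g1] - formal [:: g1 ** g2]) a + m%:R * coeff (bd2 d) a).
rewrite -[(_ + coeff (bd2 d)) a]/(_ + coeff (bd2 d) a) [RHS]mulrDr; congr (_ + _).
rewrite !coeff_cons [coeff [::] a]/coeff big_nil -Hz /=.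
rewrite -[(formal _ - formal _) a]/(_ - _) !formal_consE !formal_nil.
rewrite -mulrA; congr (_ * _).
by case: asboolP => _; case: asboolP => _; case: asboolP => _ /=; ring.
Qed.

Lemma formal_nseqE n g a : formal (nseq n g) a = n%:R * (`[< g = a >])%:R.
Proof.
elim: n => [|n IH]; first by rewrite formal_nil mul0r.
by rewrite [nseq _ _]/= formal_consE IH mulrS mulrDl mul1r.
Qed.

(** A list may mention generators outside [N] whose terms cancel. Such entries are dropped, so
    agreement is claimed on [N] only. *)
Lemma integral_lists m (c : seq (rat * G)) :
  (forall q, q \in [seq p.1 | p <- c] -> exists z : int, m%:R * q = z%:~R) ->
  exists xs ys, [/\ all_in N xs, all_in N ys &
    forall a, N a -> formal xs a - formal ys a = m%:R * coeff c a].
Proof.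
elim: c => [|[q g] c IH] Hm.
  by exists [::], [::]; split=> // a _; rewrite subrr /coeff big_nil mulr0.
have [|xs [ys [Nxs Nys E]]] := IH.
  by move=> q' q'c; apply: Hm; rewrite inE q'c orbT.
have [|z Hz] := Hm q; first by rewrite inE eqxx.
have [Ng|Ng] := pselect (N g); last first.
  exists xs, ys; split=> // a Na; rewrite coeff_cons /=; case: asboolP => [ga|_].
    by rewrite ga in Ng.
  by rewrite add0r E.
have coeffE a : m%:R * coeff ((q, g) :: c) a = z%:~R * (`[< g = a >])%:R + m%:R * coeff c a.
  rewrite coeff_cons mulrDr -Hz /=; congr (_ + _).
  by case: asboolP => _; rewrite ?mulr1 ?mulr0.
case: z Hz coeffE => n _ coeffE.
  exists (nseq n g ++ xs), ys; split=> [||a Na] //.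
    by apply/all_in_cat; split=> //; exact: all_in_nseq.
  by rewrite coeffE formal_cat -[(_ + _) a]/(_ + _) formal_nseqE -E // addrA.
exists xs, (nseq n.+1 g ++ ys); split=> [||a Na] //.
  by apply/all_in_cat; split=> //; exact: all_in_nseq.
rewrite coeffE formal_cat -[(_ + _) a]/(_ + _) formal_nseqE -E //.
by rewrite NegzE mulrNz mulNr opprD addrCA.
Qed.

Lemma formal_notin s a : all_in N s -> ~ N a -> formal s a = 0.
Proof.
move=> Ns Na; apply/le_anti; rewrite formal_ge0 andbT leNgt; apply/negP.
by move=> /formal_in /Ns.
Qed.

Lemma int_rep_exists (c : seq (rat * G)) : in_CQ N c ->
  exists m xs ys, int_rep N c m xs ys.
Proof.
move=> [cN [d [Nd cd]]].
(* The multiple must be integral for [c] and also for the 2-chain [d] bounding it, so that the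
   boundary relation can be read in integral chains. *)
have [m [m0 Hm]] := common_denominator ([seq p.1 | p <- c] ++ [seq p.1 | p <- d]).
have [|xs [ys [Nxs Nys E]]] := @integral_lists m c.
  by move=> q qc; apply: Hm; rewrite mem_cat qc.
have Ea a : formal xs a - formal ys a = m%:R * coeff c a.
  have [Na|Na] := pselect (N a); first exact: E.
  rewrite !formal_notin // subrr; have [->|/eqP/cN//] := coeff c a =P 0.
  by rewrite mulr0.
exists m, xs, ys; split=> //; last first.
  by move=> a; rewrite coeff_scale -Ea coeff_cat coeff_opp.
have [k] : exists k, cl_near N k (part_prod xs) (part_prod ys).
  apply: part_kernel_near.
  have -> : formal xs - formal ys = (fun a => m%:R * coeff (bd2 d) a).
    by apply/funext => a; rewrite -cd -Ea.
  by apply: part_kernel_bd2 => // q qd; apply: Hm; rewrite mem_cat qd orbT.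
rewrite !part_prod_id // => Hk.
apply/in_mixed_commP; exists (size ys + k)%N; rewrite gprod_cat.
have := cl_nearMl normN (gprod xs) (powprodV normN Nys 1).
by rewrite !powprod1 => /cl_le_near; apply.
Qed.
End IntegralRepresentation.

(** * Bavard duality for rational chains *)

Unset Implicit Arguments.
Set Strict Implicit.

Theorem theorem5p22 (G : group) (N : G -> Prop) (c : seq (rat * G)) :
  normal_subgroup N -> in_CQ N c ->
  ((scl_chain N c)%:E =
     if `[< bavard_set N c = set0 >] then 0%E
     else ereal_sup [set x%:E | x in bavard_set N c])%E.
Proof.
move=> normN /(int_rep_exists normN)[m0 [xs0 [ys0 rep0]]].
rewrite /scl_chain.
set P := fun t : nat * (seq G * seq G) => int_rep N c t.1 t.2.1 t.2.2.
set t := ClassicalEpsilon.epsilon _ _.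
(* Only the specification of the chosen representation is used, so the value does not depend on the
   choice. *)
have : P t by apply: ClassicalEpsilon.epsilon_spec; exists (m0, (xs0, ys0)).
case: t => m [xs ys] [/= m_gt0 Nxs Nys Mzs crep].
set zs := xs ++ _ in Mzs *.
have Nzs : all_in N zs by apply/all_in_cat; split=> //; exact: all_in_inv.
have mR0 : 0 < m%:R :> R by rewrite ltr0n.
(* The quotient in [scl_chain] was parsed as [Rdiv]. *)
rewrite RdivE.
have evalE mu : in_QNG N mu -> \sum_(z <- zs) mu z = m%:R * eval_chain mu c.
  move=> QNGmu; have := eval_chain_eq mu crep.
  rewrite eval_chain_scale ratr_nat => ->; rewrite eval_chain_cat /eval_chain !big_map /=.
  rewrite big_cat big_map /=; congr (_ + _).
    by apply: eq_bigr => x _; rewrite rmorph1 mul1r.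
  elim: (ys) Nys => [|y s IH] => [_|/all_in_cons[Ny Ns]]; first by rewrite !big_nil.
  by rewrite !big_cons IH // rmorphN1 mulN1r (quasimorphismV QNGmu).
have [upper [mu [QNGmu muD sclmu]]] := scl_list_bavard normN Nzs Mzs.
have defectP nu : in_QNG N nu -> forall h1 h2, N h1 -> N h2 ->
    `|nu (gmul h1 h2) - nu h1 - nu h2| <= defect N nu.
  move=> [[D HD] _ _] h1 h2 N1 N2; apply: ub_le_sup; last by exists h1 => //; exists h2.
  by exists D => _ [a Na [b Nb <-]]; exact: HD.
have defect_gt0 nu : in_QNG N nu -> ~ is_hom_on N nu -> 0 < defect N nu.
  move=> Qnu; apply: contra_notT; rewrite -leNgt => D0 h1 h2 N1 N2.
  have := le_trans (defectP nu Qnu h1 h2 N1 N2) D0.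
  by rewrite normr_le0 => /eqP; lra.
have upperc q : bavard_set N c q -> q <= scl_list N zs / m%:R.
  move=> [nu [Qnu nhom] <-]; have D0 := defect_gt0 nu Qnu nhom.
  rewrite ler_pdivlMr // mulrAC ler_pdivrMr ?mulr_gt0 //.
  have := upper nu _ Qnu (defectP nu Qnu).
  by rewrite evalE // normrM (ger0_norm (ltW mR0)) => ?; lra.
have nneg q : bavard_set N c q -> 0 <= q.
  move=> [nu [Qnu nhom] <-]; have D0 := defect_gt0 nu Qnu nhom.
  by rewrite divr_ge0 // mulr_ge0 // ltW.
have scl0 : 0 <= scl_list N zs.
  have := upper mu _ QNGmu muD; rewrite mulfV // mul1r; exact: le_trans.
have attained : scl_list N zs = 0 \/
    exists2 q, bavard_set N c q & scl_list N zs / m%:R <= q.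
  have [hom|nhom] := pselect (is_hom_on N mu); [left|right].
    apply/le_anti; rewrite scl0 andbT; apply: (le_trans sclmu).
    (* A homomorphism admits the bound [D = 0], and the estimate at exponent [1] makes it vanish on
       [zs], whose product lies in [[G, N]]. *)
    have muD0 h1 h2 : N h1 -> N h2 -> `|mu (gmul h1 h2) - mu h1 - mu h2| <= 0.
      by move=> N1 N2; rewrite hom // addrAC addrK subrr normr0.
    have [k Hk] := (in_mixed_commP N _).1 Mzs.
    have Hk1 : cl_le N k (powprod 1 zs) by rewrite powprod1.
    have := quasimorphism_powprod normN QNGmu muD0 Nzs Hk1.
    by rewrite mul1r mul0r normr_le0 => /eqP ->.
  have D0 := defect_gt0 mu QNGmu nhom.
  (* Dividing by [2 * defect N mu <= 1] cannot decrease the value, so [mu] reaches at least scl. *)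
  have D1 : 2 * defect N mu <= 1.
    rewrite -ler_pdivlMl // mulr1.
    apply: ge_sup; last by move=> _ [a Na [b Nb <-]]; exact: muD.
    have N1 := nsub1 normN.
    by exists (`|mu (gmul (gone G) (gone G)) - mu (gone G) - mu (gone G)|),
       (gone G) => //; exists (gone G).
  exists (`|eval_chain mu c| / (2 * defect N mu)); first by exists mu.
  rewrite ler_pdivlMr ?mulr_gt0 // mulrAC ler_pdivrMr //.
  apply: (@le_trans _ _ (scl_list N zs)); first by rewrite ler_piMr.
  rewrite (le_trans sclmu) // evalE // (le_trans (ler_norm _)) // normrM.
  by rewrite (ger0_norm (ltW mR0)) mulrC.
case: asboolP => [empty|/eqP/set0P[q0 Bq0]].
  case: attained => [->|[q]]; first by rewrite mul0r.
  by rewrite empty.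
apply/le_anti/andP; split; last first.
  by apply: ge_ereal_sup => _ [q Bq <-]; rewrite lee_fin; exact: upperc.
(* If scl vanishes, any member of the nonempty set witnesses that the supremum is at least [0]. *)
case: attained => [->|[q Bq sclq]].
  rewrite mul0r; apply: (@le_trans _ _ q0%:E); first by rewrite lee_fin nneg.
  by apply: ereal_sup_ubound; exists q0.
apply: (@le_trans _ _ q%:E); first by rewrite lee_fin.
by apply: ereal_sup_ubound; exists q.
Qed.
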